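(* Let $G=(V,E)$ be a simple graph with $V=[n]=\{1,2,\dots,n\}$. Then $$(-1)^n\chi(G,-x)=\Psi(G,x)=\sum_{\pi\in \mathcal{P}(V)}\binom{x+\delta_G(\pi)}{n}$$ (as polynomials in $x$) if and only if $\mathcal{W}(G)=\emptyset$.
   Context: $\chi(G,x)$ is the chromatic polynomial of $G$. For $u,v\in V$ let $\delta_G(u,v)=1$ if $u<v$ or $uv\in E$, and $\delta_G(u,v)=0$ otherwise. $\mathcal{P}(V)$ is the set of all $n!$ orderings of the elements of $V$; for $\pi=(u_1,\dots,u_n)\in\mathcal{P}(V)$, $\delta_G(\pi)=\sum_{i=1}^{n-1}\delta_G(u_i,u_{i+1})$. For an integer $k$, $\binom{x+k}{n}$ denotes the polynomial $(x+k)(x+k-1)\cdots(x+k-n+1)/n!$. $\mathcal{W}(G)$ is the set of $3$-element subsets $\{a,b,c\}\subseteq V$ with $a<b<c$ such that $ac$ is the only edge of the subgraph of $G$ induced by $\{a,b,c\}$ (i.e. $ac\in E$, $ab\notin E$, $bc\notin E$). *)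

(* Defs.v *)
From HB Require Import structures.
From mathcomp Require Import all_boot all_order all_algebra.

Set Implicit Arguments.
Unset Strict Implicit.
Unset Printing Implicit Defensive.

Import Order.TTheory GRing.Theory Num.Theory.
Local Open Scope ring_scope.

(* A simple graph on [n] is a symmetric irreflexive e : rel 'I_n; the vertex
   i + 1 of [n] is represented by i : 'I_n, which preserves the order. *)

Definition proper_coloring (n : nat) (e : rel 'I_n) (k : nat)
    (f : {ffun 'I_n -> 'I_k}) : bool :=
  [forall u, forall v, e u v ==> (f u != f v)].

Definition num_colorings (n : nat) (e : rel 'I_n) (k : nat) : nat :=
  #|[set f : {ffun 'I_n -> 'I_k} | proper_coloring e f]|.

(* (x + k)(x + k - 1) ... (x + k - n + 1) / n! *)
Definition binom_poly (k : int) (n : nat) : {poly rat} :=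
  (n`!%:R)^-1 *: \prod_(i < n) ('X + (k - i%:Z)%:~R%:P).

Lemma horner_binom_poly0 (j k : nat) :
  (binom_poly 0 j).[k%:R] = 'C(k, j)%:R.
Proof.
rewrite /binom_poly hornerZ horner_prod.
have -> : \prod_(i < j) ('X + (0 - i%:Z)%:~R%:P).[k%:R] = (k ^_ j)%:R :> rat.
  elim: j => [|j IHj]; first by rewrite big_ord0 ffactn0.
  rewrite big_ord_recr /= IHj ffactnSr natrM hornerD hornerX hornerC sub0r mulrNz.
  have [le_jk|lt_kj] := leqP j k; first by rewrite natrB.
  by rewrite ffact_small // !mul0r.
rewrite -bin_ffact natrM mulrC mulfK //.
by rewrite pnatr_eq0 -lt0n fact_gt0.
Qed.

Lemma num_colorings_image (n : nat) (e : rel 'I_n) (k : nat) (A : {set 'I_k}) :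
  #|[set f : {ffun 'I_n -> 'I_k} | proper_coloring e f & f @: 'I_n == A]|
  = #|[set f : {ffun 'I_n -> 'I_#|A|} |
        proper_coloring e f & f @: 'I_n == setT]|.
Proof.
pose h (g : {ffun 'I_n -> 'I_#|A|}) : {ffun 'I_n -> 'I_k} :=
  [ffun u => enum_val (g u)].
have h_inj : injective h.
  move=> g1 g2 /ffunP eqg; apply/ffunP => u.
  by have := eqg u; rewrite !ffunE => /enum_val_inj.
rewrite -(card_imset _ h_inj); apply: eq_card => f; rewrite inE.
apply/andP/imsetP => [[fP /eqP fA]|[g]].
  have fin u : f u \in A by rewrite -fA imset_f.
  pose g : {ffun 'I_n -> 'I_#|A|} := [ffun u => enum_rank_in (fin u) (f u)].
  have gE u : enum_val (g u) = f u by rewrite ffunE enum_rankK_in.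
  exists g; last by apply/ffunP => u; rewrite ffunE gE.
  rewrite inE; apply/andP; split.
    apply/forallP => u; apply/forallP => v; apply/implyP => euv.
    have /forallP/(_ u)/forallP/(_ v)/implyP/(_ euv) := fP.
    by apply: contra => /eqP guv; rewrite -!gE guv.
  apply/eqP/setP => c; rewrite inE; apply/imsetP.
  have : enum_val c \in f @: 'I_n by rewrite fA enum_valP.
  by case/imsetP => u _ cE; exists u => //; apply: enum_val_inj; rewrite gE.
rewrite inE => /andP[gP /eqP gT] ->; split.
  apply/forallP => u; apply/forallP => v; apply/implyP => euv.
  have /forallP/(_ u)/forallP/(_ v)/implyP/(_ euv) := gP.
  by rewrite !ffunE (inj_eq enum_val_inj).
apply/eqP/setP => c; apply/imsetP/idP => [[u _ ->]|cA].
  by rewrite ffunE enum_valP.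
have : enum_rank_in cA c \in g @: 'I_n by rewrite gT inE.
by case/imsetP => u _ cE; exists u => //; rewrite ffunE -cE enum_rankK_in.
Qed.

Lemma chromatic_poly_exists (n : nat) (e : rel 'I_n) :
  {p : {poly rat} | forall k : nat, p.[k%:R] = (num_colorings e k)%:R}.
Proof.
pose s j := #|[set f : {ffun 'I_n -> 'I_j} |
                proper_coloring e f & f @: 'I_n == setT]|.
exists (\sum_(j < n.+1) (s j)%:R *: binom_poly 0 j) => k.
have numE : num_colorings e k = (\sum_(A : {set 'I_k}) s #|A|)%N.
  rewrite /num_colorings -sum1_card
    (partition_big (fun f : {ffun 'I_n -> 'I_k} => f @: 'I_n) predT) //=.
  apply: eq_bigr => A _; rewrite /s -num_colorings_image -sum1_card.
  by apply: eq_bigl => f; rewrite !inE.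
have s0 j : (n < j)%N -> s j = 0%N.
  move=> lt_nj; apply/eqP; rewrite cards_eq0; apply/eqP/setP => f.
  rewrite !inE; apply/negbTE; rewrite negb_and; apply/orP; right.
  apply: contraL lt_nj => /eqP fT; rewrite -leqNgt.
  by rewrite -[j]card_ord -cardsT -fT -[n in leqRHS]card_ord leq_imset_card.
have {}numE : num_colorings e k = (\sum_(j < n.+1) s j * 'C(k, j))%N.
  rewrite numE (bigID (fun A : {set 'I_k} => (#|A| < n.+1)%N)) /=.
  rewrite [X in (_ + X)%N]big1 ?addn0; last first.
    by move=> A; rewrite -leqNgt => /s0.
  rewrite (partition_big (fun A : {set 'I_k} => inord #|A| : 'I_n.+1) predT) //=.
  apply: eq_bigr => j _.
  rewrite -[k in 'C(k, _)]card_ord -card_draws mulnC -sum_nat_const.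
  apply: congr_big => // [A|A].
    rewrite inE; apply/andP/eqP => [[ltA /eqP <-]|->]; first by rewrite inordK.
    by rewrite ltn_ord inord_val.
  by case/andP=> ltA /eqP <-; rewrite inordK.
rewrite numE horner_sum natr_sum; apply: eq_bigr => j _.
by rewrite hornerZ horner_binom_poly0 natrM.
Qed.

(* The polynomial whose value at every k : nat is the number of proper
   k-colourings; it is determined by these values. *)
Definition chromatic_poly (n : nat) (e : rel 'I_n) : {poly rat} :=
  sval (chromatic_poly_exists e).

Lemma chromatic_polyP (n : nat) (e : rel 'I_n) (k : nat) :
  (chromatic_poly e).[k%:R] = (num_colorings e k)%:R.
Proof. exact: (svalP (chromatic_poly_exists e)). Qed.

Lemma chromatic_poly_uniq (n : nat) (e : rel 'I_n) (p : {poly rat}) :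
  (forall k : nat, p.[k%:R] = (num_colorings e k)%:R) -> p = chromatic_poly e.
Proof.
move=> pE; apply/eqP; rewrite -subr_eq0; apply/eqP.
set q := p - _.
apply: (@roots_geq_poly_eq0 _ q [seq k%:R | k <- iota 0 (size q)]).
- apply/allP => _ /mapP[k _ ->].
  by rewrite /root hornerD hornerN pE chromatic_polyP subrr.
- rewrite map_inj_uniq ?iota_uniq // => i j /eqP.
  by rewrite eqr_nat => /eqP.
- by rewrite size_map size_iota.
Qed.

Definition delta (n : nat) (e : rel 'I_n) (u v : 'I_n) : nat :=
  ((u < v)%N || e u v).

Definition orderings (n : nat) : {set n.-tuple 'I_n} :=
  [set p : n.-tuple 'I_n | uniq p].

(* zip truncates, so the sum is over the pairs (u_i, u_(i+1)), 1 <= i <= n-1. *)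
Definition delta_ordering (n : nat) (e : rel 'I_n) (p : n.-tuple 'I_n) : nat :=
  (\sum_(uv <- zip p (behead p)) delta e uv.1 uv.2)%N.

Definition Psi (n : nat) (e : rel 'I_n) : {poly rat} :=
  \sum_(p in orderings n) binom_poly (delta_ordering e p)%:Z n.

Definition W (n : nat) (e : rel 'I_n) : {set {set 'I_n}} :=
  [set A : {set 'I_n} | [exists a : 'I_n, exists b : 'I_n, exists c : 'I_n,
     [&& (a < b)%N, (b < c)%N, A == [set a; b; c],
         e a c, ~~ e a b & ~~ e b c]]].

(* Main.v *)
(** By binomial reciprocity, [(-1)^n Psi(G, -m)] is the sum over the orderings
    [pi] of ['C(m + n - 1 - delta(pi), n)], which counts the maps [f : V -> [m]]
    that are weakly increasing along [pi], strictly so at the steps where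
    [delta = 1].  A step between two vertices of the same colour must thus go
    down along a non-edge, so [f] admits at most one [pi] (sort by colour, then
    by decreasing vertex), and it admits one iff no two consecutive vertices of
    a colour class are adjacent.  All proper colourings have this property; for
    every [m] they are the only ones iff no edge [ac] can be hidden by some [b]
    between [a] and [c] adjacent to neither, i.e. iff [W] is empty. *)

Require Import Defs.
From mathcomp Require Import all_boot all_order all_algebra.
From mathcomp Require Import zify.

Set Implicit Arguments.
Unset Strict Implicit.
Unset Printing Implicit Defensive.

Import Order.TTheory GRing.Theory Num.Theory.
Local Open Scope ring_scope.

(** * Consecutive entries of a sorted sequence *)

(** Neighbours in a duplicate-free sorted sequence are exactly the covering pairs of [le], so [r]
    can be tested on covers, without positions. *)
Lemma sorted_coverP (T : eqType) (le r : rel T) (s : seq T) :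
    transitive le -> antisymmetric le -> uniq s -> sorted le s ->
  (forall x y, x \in s -> y \in s -> x != y -> le x y ->
     (forall z, z \in s -> le x z -> le z y -> z = x \/ z = y) -> r x y)
  <-> sorted r s.
Proof.
move=> le_tr le_anti s_uniq s_sorted.
split=> [covers|r_sorted x y xs ys neq_xy le_xy cover_xy].
  case: s => [|x0 s] // in s_uniq s_sorted covers *.
  apply/(sortedP x0) => i lt_i; have lt_i' := ltnW lt_i.
  set t := x0 :: s in s_uniq s_sorted covers lt_i lt_i' *.
  apply: covers; rewrite ?mem_nth //.
  - by rewrite nth_uniq // neq_ltn leqnn.
  - by move/(sortedP x0): s_sorted; apply.
  move=> z zs le_xz le_zy.
  have iE := index_uniq x0 lt_i' s_uniq; have jE := index_uniq x0 lt_i s_uniq.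
  (* No index lies strictly between [i] and [i.+1], so [z] is weakly on one side; antisymmetry then
     makes it an endpoint. *)
  have [le_ki|lt_ik] := leqP (index z t) i.
    left; move: le_ki; rewrite leq_eqVlt => /orP[/eqP <-|lt_ki].
      by rewrite nth_index.
    apply: le_anti; rewrite le_xz andbT.
    by apply: (sorted_ltn_index le_tr s_sorted); rewrite ?mem_nth // iE.
  right; move: lt_ik; rewrite leq_eqVlt => /orP[/eqP ->|lt_ik].
    by rewrite nth_index.
  apply: le_anti; rewrite le_zy.
  by apply: (sorted_ltn_index le_tr s_sorted); rewrite ?mem_nth // jE.
have lt_xy : (index x s < index y s)%N.
  rewrite ltnNge leq_eqVlt; apply/negP => /orP[/eqP eq_yx|lt_yx].
    by move: neq_xy; rewrite -(nth_index x xs) -eq_yx nth_index ?eqxx.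
  case/eqP: neq_xy; apply: le_anti; rewrite le_xy.
  exact: (sorted_ltn_index le_tr s_sorted).
have lt_ys : (index y s < size s)%N by rewrite index_mem.
have step i : (i.+1 < size s)%N -> r (nth x s i) (nth x s i.+1).
  by move/(sortedP x): r_sorted; apply.
have lt_zs := leq_ltn_trans lt_xy lt_ys.
have := step _ lt_zs; rewrite nth_index //.
move: lt_xy; rewrite leq_eqVlt => /orP[/eqP ->|lt_zy]; first by rewrite nth_index.
have zE := index_uniq x lt_zs s_uniq.
(* The entry right after [x] lies between [x] and [y], hence is one of them; uniqueness rules out
   [x]. *)
case: (cover_xy (nth x s (index x s).+1)); rewrite ?mem_nth //.
- by apply: (sorted_ltn_index le_tr s_sorted); rewrite ?mem_nth // zE.
- by apply: (sorted_ltn_index le_tr s_sorted); rewrite ?mem_nth // zE.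
- by move=> eq_zx; move: zE; rewrite eq_zx => /n_Sn.
- by move=> ->.
Qed.

(** * Counting the maps compatible with one ordering *)

(** Each step gains at least 1; this gives the bounds needed to undo the shift by [c] below. *)
Lemma sorted_ltn_nthD (s : seq nat) (i j : nat) :
    sorted ltn s -> (i <= j)%N -> (j < size s)%N ->
  (nth 0 s i + (j - i) <= nth 0 s j)%N.
Proof.
move=> /(sortedP 0%N) s_lt; elim: j => [|j IHj] le_ij lt_j.
  by move: le_ij; rewrite leqn0 => /eqP ->; rewrite addn0.
have [eq_ij|lt_ij] := eqVneq i j.+1; first by rewrite eq_ij subnn addn0.
have := IHj _ (ltnW lt_j); have := s_lt j lt_j; rewrite /=; lia.
Qed.

Lemma mem_uniq_tuple (n : nat) (p : n.-tuple 'I_n) (u : 'I_n) :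
  uniq p -> u \in p.
Proof.
move=> p_uniq; have /subset_cardP/(_ (subset_predT _)) -> // : #|p| = #|'I_n|.
by rewrite (card_uniqP p_uniq) size_tuple card_ord.
Qed.

(* Adding the number [c i] of weak steps before position [i] turns weak
   inequalities into strict ones. *)
Lemma card_shift_sorted (n m : nat) (c : nat -> nat) (p : n.-tuple 'I_n) :
    uniq p -> c 0%N = 0%N -> (forall i, (c i <= c i.+1 <= (c i).+1)%N) ->
  #|[set f : {ffun 'I_n -> 'I_m} |
      sorted ltn [seq (f (tnth p i) + c i)%N | i : 'I_n]]| = 'C(m + c n.-1, n).
Proof.
move=> p_uniq c0 cS.
have c_mono i j : (i <= j)%N -> (c i <= c j <= c i + (j - i))%N.
  elim: j => [|j IHj]; first by rewrite leqn0 => /eqP ->; rewrite addn0 leqnn.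
  rewrite leq_eqVlt => /orP[/eqP ->|lt_ij]; first by rewrite subnn addn0 leqnn.
  have := IHj lt_ij; have := cS j; lia.
have shift_lt (f : {ffun 'I_n -> 'I_m}) (i : 'I_n) :
    (f (tnth p i) + c i < m + c n.-1)%N.
  have := ltn_ord (f (tnth p i)); have := c_mono i n.-1; have := ltn_ord i; lia.
pose h (f : {ffun 'I_n -> 'I_m}) : n.-tuple 'I_(m + c n.-1) :=
  [tuple Ordinal (shift_lt f i) | i < n].
have p_all u := mem_uniq_tuple u p_uniq.
have h_inj : injective h.
  move=> f g eq_fg; apply/ffunP => u; have /tnthP[i ->] := p_all u.
  apply: val_inj; have /(congr1 (fun t => val (tnth t i))) := eq_fg.
  by rewrite !tnth_mktuple /= => /addIn.
rewrite -card_ltn_sorted_tuples -(card_imset _ h_inj).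
have h_val f : [seq val i | i <- h f] = [seq (f (tnth p i) + c i)%N | i : 'I_n].
  by rewrite -map_comp; apply: eq_map.
apply: eq_card => t; rewrite inE; apply/imsetP/idP => [[f + ->]|t_lt].
  by rewrite inE h_val.
have t_nth (i : 'I_n) : nth 0%N [seq val k | k <- t] i = tnth t i.
  by rewrite (nth_map (tnth t i)) ?size_tuple // -tnth_nth.
have t_size : size [seq val k | k <- t] = n by rewrite size_map size_tuple.
have c_le (i : 'I_n) : (c i <= tnth t i)%N.
  have := @sorted_ltn_nthD _ 0 i t_lt (leq0n _); rewrite t_size t_nth.
  move=> /(_ (ltn_ord i)); have := c_mono 0%N i (leq0n _); lia.
(* The last entry is below [m + c n.-1], entry [i] is at least [n.-1 - i] smaller, and [c] grows by
   at most that much after [i]. *)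
have sub_lt (i : 'I_n) : (tnth t i - c i < m)%N.
  have lt_in := ltn_ord i; have lt_n : (n.-1 < n)%N by lia.
  have := @sorted_ltn_nthD _ i n.-1 t_lt; rewrite t_size t_nth.
  rewrite (t_nth (Ordinal lt_n)).
  have := ltn_ord (tnth t (Ordinal lt_n)); have := c_mono i n.-1; have := c_le i.
  lia.
have idx_lt u : (index u p < n)%N by rewrite -[X in (_ < X)%N](size_tuple p) index_mem.
pose f : {ffun 'I_n -> 'I_m} := [ffun u => Ordinal (sub_lt (Ordinal (idx_lt u)))].
have tE : t = h f.
  apply: eq_from_tnth => i; apply: val_inj; rewrite tnth_mktuple /= ffunE /=.
  have idxE : index (tnth p i) p = i.
    by rewrite {1}(tnth_nth (tnth p i)) index_uniq ?size_tuple.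
  have -> : Ordinal (idx_lt (tnth p i)) = i by apply: val_inj.
  by rewrite idxE subnK.
by exists f => //; rewrite inE -h_val -tE.
Qed.

(* [delta] is [0] or [1]: the step is strict exactly when [delta = 1]. *)
Definition weak_step (n m : nat) (e : rel 'I_n) (f : {ffun 'I_n -> 'I_m}) :
    rel 'I_n :=
  fun u v => (f u + delta e u v <= f v)%N.

Lemma delta_ordering_count (n : nat) (e : rel 'I_n) (p : n.-tuple 'I_n) :
  (delta_ordering e p
   + count (fun uv => delta e uv.1 uv.2 == 0%N) (zip p (behead p)) = n.-1)%N.
Proof.
have -> : delta_ordering e p
    = count (fun uv => delta e uv.1 uv.2 != 0%N) (zip p (behead p)).
  rewrite /delta_ordering -sum1_count [RHS]big_mkcond /=.
  by apply: eq_bigr => uv _; rewrite /delta; case: (_ || _).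
rewrite addnC count_predC size_zip size_behead size_tuple.
by apply/minn_idPr; rewrite leq_pred.
Qed.

Lemma card_weak_step_sorted (n m : nat) (e : rel 'I_n) (p : n.-tuple 'I_n) :
    uniq p ->
  #|[set f : {ffun 'I_n -> 'I_m} | sorted (weak_step e f) p]|
  = 'C(m + (n.-1 - delta_ordering e p), n).
Proof.
move=> p_uniq; set z := zip p (behead p).
pose a uv := delta e uv.1 uv.2 == 0%N.
pose c i := count a (take i z).
have z_size : size z = n.-1.
  by rewrite size_zip size_behead size_tuple; apply/minn_idPr; rewrite leq_pred.
have cS uv0 i : (i < n.-1)%N -> c i.+1 = (c i + a (nth uv0 z i))%N.
  by move=> lt_i; rewrite /c (take_nth uv0) ?z_size // -cats1 count_cat /= addn0.
have -> : (n.-1 - delta_ordering e p = c n.-1)%N.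
  by rewrite /c take_oversize ?z_size // -(delta_ordering_count e p) addKn.
rewrite -(card_shift_sorted m p_uniq) => [||i]; last 2 first.
- by rewrite /c take0.
- have [lt_i|le_i] := ltnP i n.-1; last first.
    by rewrite /c !take_oversize ?z_size ?leqnSn ?leqnn // ltnW.
  have lt0n : (0 < n)%N by lia.
  rewrite (cS (Ordinal lt0n, Ordinal lt0n)) //; case: (a _); lia.
apply: eq_card => f; rewrite !inE.
have [n0|/card_gt0P[u0 _]] := posnP #|'I_n|.
  have -> : [seq (f (tnth p i) + c i)%N | i : 'I_n] = [::].
    by apply: size0nil; rewrite size_map -cardE.
  by rewrite (size0nil (_ : size p = 0%N)) // size_tuple -(card_ord n).
have mapE j (lt_j : (j < n)%N) :
    nth 0%N [seq (f (tnth p k) + c k)%N | k : 'I_n] j = (f (nth u0 p j) + c j)%N.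
  rewrite (nth_map (Ordinal lt_j)) -?cardE ?card_ord //.
  by rewrite (tnth_nth u0) nth_enum_ord.
(* [c] grows by [1 - delta] at each step, which makes the weak and strict cases one strict
   inequality. *)
have stepE i : (i.+1 < n)%N ->
    weak_step e f (nth u0 p i) (nth u0 p i.+1)
    = (f (nth u0 p i) + c i < f (nth u0 p i.+1) + c i.+1)%N.
  move=> lt_i; rewrite (cS (u0, u0)); last lia.
  rewrite nth_zip_cond -/z z_size ifT; last lia.
  rewrite /weak_step /a /= nth_behead /delta; case: (_ || _) => /=; lia.
have map_size : size [seq (f (tnth p k) + c k)%N | k : 'I_n] = n.
  by rewrite size_map -cardE card_ord.
apply/(sortedP u0)/(sortedP 0%N); rewrite map_size size_tuple => step i lt_i;
  by move: (step i lt_i); rewrite stepE // !mapE // ltnW.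
Qed.

(** * The only ordering that a map can admit *)

(** Ties put the larger vertex first, since a step inside a colour class needs [delta] to be 0 and
    so cannot go up. *)
Definition color_order (n m : nat) (f : {ffun 'I_n -> 'I_m}) : rel 'I_n :=
  fun u v => (f u < f v)%N || ((f u == f v :> nat) && (v <= u)%N).

Lemma color_order_trans (n m : nat) (f : {ffun 'I_n -> 'I_m}) :
  transitive (color_order f).
Proof. move=> v u w; rewrite /color_order; lia. Qed.

Lemma color_order_anti (n m : nat) (f : {ffun 'I_n -> 'I_m}) :
  antisymmetric (color_order f).
Proof. move=> u v uv; apply: val_inj => /=; move: uv; rewrite /color_order; lia. Qed.

Lemma color_order_total (n m : nat) (f : {ffun 'I_n -> 'I_m}) :
  total (color_order f).
Proof. move=> u v; rewrite /color_order; lia. Qed.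

Lemma weak_step_color_order (n m : nat) (e : rel 'I_n) (f : {ffun 'I_n -> 'I_m}) :
  subrel (weak_step e f) (color_order f).
Proof.
move=> u v; rewrite /weak_step /delta /color_order.
case: (ltnP u v) => [_|le_vu] /=; [|case: (e u v)] => /=; lia.
Qed.

(** Equivalently, vertices consecutive within a colour class are never adjacent. *)
Definition consecutive_proper (n m : nat) (e : rel 'I_n)
    (f : {ffun 'I_n -> 'I_m}) : bool :=
  [forall a : 'I_n, forall c : 'I_n, [&& (a < c)%N, e a c & f a == f c] ==>
     [exists b : 'I_n, (a < b < c)%N && (f b == f a)]].

(** A cover of [color_order] either raises the colour, which any step allows, or goes down between
    consecutive vertices of a class, where [delta] is 0 iff they are not adjacent. *)
Lemma sorted_weak_stepE (n m : nat) (e : rel 'I_n) (f : {ffun 'I_n -> 'I_m}) :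
    symmetric e ->
  sorted (weak_step e f) (sort (color_order f) (enum 'I_n))
  = consecutive_proper e f.
Proof.
move=> e_sym.
have s_uniq : uniq (sort (color_order f) (enum 'I_n)).
  by rewrite sort_uniq enum_uniq.
have in_s u : u \in sort (color_order f) (enum 'I_n).
  by rewrite mem_sort mem_enum.
have coverP := sorted_coverP (weak_step e f) (@color_order_trans _ _ f)
  (@color_order_anti _ _ f) s_uniq (sort_sorted (@color_order_total _ _ f) _).
apply/idP/idP => [/coverP cover|/forallP prop].
  apply/forallP => a; apply/forallP => c; apply/implyP => /and3P[lt_ac e_ac /eqP f_ac].
  apply: contraT => /existsPn no_b.
  have : weak_step e f c a.
    apply: cover => //; [by rewrite neq_ltn lt_ac orbT| |move=> z _ le_cz le_za].
      by rewrite /color_order f_ac eqxx (ltnW lt_ac) orbT.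
    have fz : f z = f a.
      by apply: val_inj => /=; move: le_cz le_za; rewrite /color_order f_ac; lia.
    have := no_b z; rewrite fz eqxx andbT negb_and -!leqNgt.
    move: le_cz le_za; rewrite /color_order fz f_ac ltnn eqxx /= => le_zc le_az.
    by case/orP => ?; [right|left]; apply: val_inj => /=; lia.
  by rewrite /weak_step /delta e_sym e_ac orbT f_ac addn1 ltnn.
apply/coverP => x y _ _ neq_xy le_xy cover.
move: (le_xy); rewrite {1}/color_order => /orP[lt_f|/andP[/eqP/val_inj eq_f le_yx]].
  by rewrite /weak_step /delta; move: lt_f; case: (_ || _) => /=; lia.
have lt_yx : (y < x)%N by rewrite ltn_neqAle le_yx andbT eq_sym.
rewrite /weak_step /delta ltnNge le_yx /= eq_f.
case: (boolP (e x y)) => [e_xy|_]; last by rewrite addn0.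
(* An edge would yield a vertex [b] of the same class between [y] and [x], so this would not be a
   cover. *)
have /forallP/(_ x) := prop y.
rewrite lt_yx e_sym e_xy eq_f eqxx /= => /existsP[b /andP[/andP[lt_yb lt_bx] /eqP fb]].
have [] := cover b; rewrite ?in_s //; first 2 last.
- by move=> b_x; rewrite b_x ltnn in lt_bx.
- by move=> b_y; rewrite b_y ltnn in lt_yb.
- by rewrite /color_order eq_f fb eqxx (ltnW lt_bx) orbT.
- by rewrite /color_order fb eqxx (ltnW lt_yb) orbT.
Qed.

Lemma card_orderings_weak_step (n m : nat) (e : rel 'I_n)
    (f : {ffun 'I_n -> 'I_m}) : symmetric e ->
  #|[set p in orderings n | sorted (weak_step e f) p]| = consecutive_proper e f.
Proof.
move=> e_sym; rewrite -sorted_weak_stepE //.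
set s := sort _ _.
have s_uniq : uniq s by rewrite sort_uniq enum_uniq.
have s_size : size s == n by rewrite size_sort -cardE card_ord.
have unique (p : n.-tuple 'I_n) : uniq p -> sorted (weak_step e f) p -> p = Tuple s_size.
  move=> p_uniq p_sorted; apply: val_inj => /=.
  apply: (sorted_eq (@color_order_trans _ _ f) (@color_order_anti _ _ f)).
  - exact: sub_sorted (@weak_step_color_order _ _ e f) _ p_sorted.
  - exact/sort_sorted/color_order_total.
  by apply: uniq_perm => // u; rewrite mem_sort mem_enum mem_uniq_tuple.
case: (boolP (sorted _ s)) => s_sorted.
  transitivity #|[set Tuple s_size]|; last by rewrite cards1.
  apply: eq_card => p; rewrite !inE.
  apply/andP/eqP => [[p_uniq]|-> //]; exact: unique.
apply/eqP; rewrite cards_eq0; apply/eqP/setP => p; rewrite !inE.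
apply/negP => /andP[p_uniq p_sorted].
by move: s_sorted; rewrite -[s]/(val (Tuple s_size)) -(unique p) ?p_sorted.
Qed.

(** * Binomial reciprocity *)

Lemma binom_poly_reflect (m d n : nat) : (d <= n.-1)%N ->
  (-1) ^+ n * (binom_poly d%:Z n).[- m%:R] = 'C(m + (n.-1 - d), n)%:R.
Proof.
move=> le_dn; rewrite /binom_poly hornerZ horner_prod mulrCA.
have -> : (-1) ^+ n * \prod_(i < n) ('X + (d%:Z - i%:Z)%:~R%:P).[- m%:R]
    = ((m + (n.-1 - d)) ^_ n)%:R :> rat.
  rewrite -[X in _ ^+ X]card_ord -prodr_const -big_split /= ffact_prod natr_prod.
  rewrite (reindex_inj rev_ord_inj) /=.
  (* For a top argument below [n], truncated subtraction spoils the factorwise match, but both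
     products have a zero factor at that index. *)
  have [small|big] := ltnP (m + (n.-1 - d)) n.
    rewrite [RHS](bigD1 (Ordinal small)) //= subnn mul0r.
    rewrite (bigD1 (Ordinal small)) //= !hornerE.
    have -> : (d%:Z - (n - (m + (n.-1 - d)).+1)%N%:Z)%:~R = m%:R :> rat.
      by rewrite pmulrn; congr (_ *~ _); lia.
    by rewrite addNr mulr0 mul0r.
  apply: eq_bigr => i _; rewrite !hornerE.
  have lt_in := ltn_ord i.
  rewrite mulN1r opprD opprK !pmulrn -mulrNz -mulrzDr.
  by congr (_ *~ _); lia.
rewrite -bin_ffact natrM mulrC mulfK //.
by rewrite pnatr_eq0 -lt0n fact_gt0.
Qed.

(** Double counting of the pairs of an ordering and a map weakly increasing along it. *)
Lemma Psi_reflect (n : nat) (e : rel 'I_n) (m : nat) : symmetric e ->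
  (-1) ^+ n * (Psi e).[- m%:R]
  = #|[set f : {ffun 'I_n -> 'I_m} | consecutive_proper e f]|%:R.
Proof.
move=> e_sym; rewrite /Psi horner_sum mulr_sumr.
under eq_bigr => p p_ord.
  rewrite binom_poly_reflect; last by rewrite -(delta_ordering_count e p) leq_addr.
  rewrite -card_weak_step_sorted; last by move: p_ord; rewrite inE.
  over.
rewrite -natr_sum; congr _%:R.
under eq_bigr do rewrite -sum1_card big_mkcond.
rewrite exchange_big /= -sum1_card [RHS]big_mkcond; apply: eq_bigr => f _.
rewrite inE -[if _ then _ else _]/(nat_of_bool _) -card_orderings_weak_step //.
rewrite -sum1_card big_mkcond [RHS]big_mkcond; apply: eq_bigr => p _.
by rewrite !inE; case: (uniq p).
Qed.

(** * Proper colourings and [W] *)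

Lemma proper_consecutive (n m : nat) (e : rel 'I_n) (f : {ffun 'I_n -> 'I_m}) :
  proper_coloring e f -> consecutive_proper e f.
Proof.
move=> /forallP f_proper; apply/forallP => a; apply/forallP => c.
apply/implyP => /and3P[_ e_ac f_ac].
by have /forallP/(_ c) := f_proper a; rewrite e_ac f_ac.
Qed.

(* A shortest monochromatic edge ac, with a < b < c of the same colour, would
   put {a, b, c} in W. *)
Lemma consecutive_proper_W0 (n m : nat) (e : rel 'I_n)
    (f : {ffun 'I_n -> 'I_m}) : symmetric e -> irreflexive e -> W e = set0 ->
  consecutive_proper e f -> proper_coloring e f.
Proof.
move=> e_sym e_irr W0 /forallP f_cons.
have f_proper k : forall a c : 'I_n, (a < c)%N -> (c - a <= k)%N -> e a c -> f a != f c.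
  elim: k => [|k IHk] a c lt_ac le_k e_ac; first by lia.
  apply/negP => /eqP f_ac.
  have /forallP/(_ c) := f_cons a; rewrite lt_ac e_ac f_ac eqxx /=.
  case/existsP => b /andP[/andP[lt_ab lt_bc] /eqP f_b].
  (* Both gaps are shorter than [c - a], so by induction an edge there would join different
     colours. *)
  have ne_ab : ~~ e a b.
    by apply/negP => /(IHk a b lt_ab); rewrite f_ac f_b eqxx => /(_ _)/negP; case; lia.
  have ne_bc : ~~ e b c.
    by apply/negP => /(IHk b c lt_bc); rewrite f_b eqxx => /(_ _)/negP; case; lia.
  have : [set a; b; c] \in W e.
    rewrite inE; apply/existsP; exists a; apply/existsP; exists b.
    by apply/existsP; exists c; rewrite lt_ab lt_bc eqxx e_ac ne_ab ne_bc.
  by rewrite W0 inE.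
apply/forallP => u; apply/forallP => v; apply/implyP => e_uv.
case: (ltngtP u v) => [lt_uv|lt_vu|/val_inj eq_uv].
- exact: f_proper lt_uv (leqnn _) e_uv.
- by rewrite eq_sym (f_proper _ _ _ lt_vu (leqnn _)) // e_sym.
- by move: e_uv; rewrite eq_uv e_irr.
Qed.

(* Witness: give [a], [b], [c] one colour and all other vertices their own. *)
Lemma W_consecutive_not_proper (n : nat) (e : rel 'I_n) : W e != set0 ->
  exists f : {ffun 'I_n -> 'I_n}, consecutive_proper e f && ~~ proper_coloring e f.
Proof.
case/set0Pn => A; rewrite inE => /existsP[a /existsP[b /existsP[c]]].
case/and5P => lt_ab lt_bc _ e_ac /andP[ne_ab ne_bc].
pose f := [ffun u => if u \in [:: b; c] then a else u]; exists f.
have fE u : f u = if u \in [:: b; c] then a else u by rewrite ffunE.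
apply/andP; split; last first.
  apply/negP => /forallP/(_ a)/forallP/(_ c).
  by rewrite e_ac !fE !inE eqxx orbT if_same eqxx.
apply/forallP => x; apply/forallP => y; apply/implyP => /and3P[lt_xy e_xy].
(* Only the class of [a], [b], [c] has several vertices; its only edge is [ac], with [b] in
   between. *)
rewrite !fE !inE; case: (eqVneq x b) => [x_b|neq_xb] /=.
  rewrite x_b in lt_xy e_xy.
  case: (eqVneq y b) => [y_b|_] /=; first by rewrite y_b ltnn in lt_xy.
  case: (eqVneq y c) => [y_c|_] /=; first by rewrite y_c (negbTE ne_bc) in e_xy.
  by move=> /eqP a_y; move: lt_xy; rewrite -a_y; lia.
case: (eqVneq x c) => [x_c|neq_xc] /=.
  rewrite x_c in lt_xy.
  case: (eqVneq y b) => [y_b|_] /=; first by rewrite y_b in lt_xy; lia.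
  case: (eqVneq y c) => [y_c|_] /=; first by rewrite y_c ltnn in lt_xy.
  by move=> /eqP a_y; move: lt_xy; rewrite -a_y; lia.
case: (eqVneq y b) => [y_b|_] /=.
  by move=> /eqP x_a; move: e_xy; rewrite x_a y_b (negbTE ne_ab).
case: (eqVneq y c) => [y_c|_] /=; last by move=> /eqP x_y; rewrite x_y ltnn in lt_xy.
move=> /eqP x_a; apply/existsP; exists b.
by rewrite x_a y_c lt_ab lt_bc fE inE eqxx /= eqxx.
Qed.

Theorem theorem1p1 (n : nat) (e : rel 'I_n)
    (e_sym : symmetric e) (e_irr : irreflexive e) :
  (-1) ^+ n *: (chromatic_poly e \Po (- 'X)) = Psi e <-> W e = set0.
Proof.
split=> [chiE|W0].
  apply/eqP/negPn/negP => /W_consecutive_not_proper[f /andP[f_cons f_nproper]].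
  (* Evaluating at [- n] suffices, as the witness [f] uses [n] colours: it makes the inclusion of
     proper colourings strict. *)
  have := Psi_reflect n e_sym; rewrite -chiE hornerZ horner_comp hornerN hornerX opprK.
  rewrite mulrA -exprMn mulrNN mulr1 expr1n mul1r chromatic_polyP.
  move/eqP; rewrite eqr_nat => /eqP/eqP; rewrite ltn_eqF //.
  apply: proper_card; apply/properP; split.
    by apply/subsetP => g; rewrite !inE; apply: proper_consecutive.
  by exists f; rewrite !inE.
(* The values at naturals determine [chromatic_poly e]; reflecting twice then restores [Psi e]. *)
have <- : (-1) ^+ n *: (Psi e \Po - 'X) = chromatic_poly e.
  apply: chromatic_poly_uniq => m; rewrite hornerZ horner_comp hornerN hornerX.
  rewrite Psi_reflect //; congr _%:R; apply: eq_card => f; rewrite !inE.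
  by apply/idP/idP; [apply: consecutive_proper_W0|apply: proper_consecutive].
rewrite comp_polyZ -comp_polyA !raddfN /= comp_polyX opprK comp_polyXr scalerA.
by rewrite -exprMn mulrNN mulr1 expr1n scale1r.
Qed.
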